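(* Let $\lambda$ be a partition and $R=(R_1,\dots,R_t)$ a sequence of rectangular partitions, $R_a$ having $\eta_a$ rows and $\mu_a$ columns, with $|\lambda|=\sum_a|R_a|$. Then $$RC_{\lambda^t;R^t}(q)=q^{n(R)}\,RC_{\lambda;R}(q^{-1}).$$
   Context: $\lambda^t$ is the conjugate partition and $R^t$ is the sequence of transposed rectangles (the $a$-th one having $\mu_a$ rows and $\eta_a$ columns). For a cell $(i,j)$ (row $i$, column $j$), $r_{i,j}(R)$ is the number of rectangles in $R$ that contain the cell $(i,j)$, and $n(R)=\sum_{(i,j)}\binom{r_{i,j}(R)}{2}$. A configuration of type $(\lambda;R)$ is a sequence of partitions $\nu=(\nu^1,\nu^2,\dots)$ with $|\nu^k|=\sum_{j>k}\lambda_j-\sum_a\mu_a\max(\eta_a-k,0)$ for all $k\ge1$; by convention $\nu^0$ is the empty partition. For a partition $\rho$, $Q_n(\rho)=\rho^t_1+\dots+\rho^t_n$. The vacancy numbers of $\nu$ are $$P_{k,n}(\nu)=Q_n(\nu^{k-1})-2Q_n(\nu^k)+Q_n(\nu^{k+1})+\sum_a\min(\mu_a,n)\,\delta_{\eta_a,k}\qquad(k,n\ge1).$$ $\nu$ is admissible if $P_{k,n}(\nu)\ge0$ for all $k,n\ge1$. A rigging $L$ of an admissible configuration $\nu$ assigns an integer label $L^k_s$ to each part $\nu^k_s$ such that $0\le L^k_s\le P_{k,\nu^k_s}(\nu)$ for all $k\ge1$, $1\le s\le\ell(\nu^k)$ (number of nonzero parts), and $L^k_s\ge L^k_{s+1}$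 whenever $\nu^k_s=\nu^k_{s+1}$. $RC(\lambda;R)$ is the set of rigged configurations $(\nu,L)$ with $\nu$ admissible of type $(\lambda;R)$ and $L$ a rigging of $\nu$. With $\alpha_{k,n}=(\nu^k)^t_n$, $$\mathrm{cocharge}(\nu,L)=\sum_{k,n\ge1}\alpha_{k,n}(\alpha_{k,n}-\alpha_{k+1,n})+\sum_{k\ge1}\sum_{s=1}^{\ell(\nu^k)}L^k_s,$$ and $RC_{\lambda;R}(q)=\sum_{(\nu,L)\in RC(\lambda;R)}q^{\mathrm{cocharge}(\nu,L)}$. For type $(\lambda^t;R^t)$ the same definitions are used with $\lambda^t$ in place of $\lambda$ and the roles of $\mu_a$ and $\eta_a$ exchanged. *)

(* Defs.v *)
From mathcomp Require Import all_boot all_order all_algebra.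
From mathcomp Require Import boolp classical_sets cardinality fsbigop.

Set Implicit Arguments.
Unset Strict Implicit.
Unset Printing Implicit Defensive.

Import GRing.Theory.
Local Open Scope classical_set_scope.
Local Open Scope ring_scope.

(* A partition is the list of its nonzero parts. The parts of [rho] are
   [nth 0 rho 0], [nth 0 rho 1], etc., so that the j-th part has index j - 1. *)
Definition is_partition (rho : seq nat) : bool :=
  sorted geq rho && (0%N \notin rho).

Definition conjp (rho : seq nat) : seq nat :=
  mkseq (fun j => count (fun x => (j < x)%N) rho) (head 0%N rho).

Definition Qn (n : nat) (rho : seq nat) : nat :=
  (\sum_(j < n) nth 0 (conjp rho) j)%N.

(* The sequence of rectangles R_1, ..., R_t is given by the functions
   [eta mu : 'I_t -> nat], the a-th rectangle having [eta a] rows and [mu a]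
   columns; the transposed sequence is obtained by exchanging [eta] and [mu]. *)

(* Cells are numbered from 1. *)
Definition rect_mult (t : nat) (eta mu : 'I_t -> nat) (i j : nat) : nat :=
  #|[set a : 'I_t | (0 < i <= eta a)%N && (0 < j <= mu a)%N]%SET|.

(* Cells outside of the range of summation lie in no rectangle. *)
Definition nR (t : nat) (eta mu : 'I_t -> nat) : nat :=
  (\sum_(1 <= i < (\max_a eta a).+1) \sum_(1 <= j < (\max_a mu a).+1)
     'C(rect_mult eta mu i j, 2))%N.

(* The partition nu^k is [nu k]; the index 0 is only used for the convention
   that nu^0 is empty. The subtraction [eta a - k] in nat is max(eta_a - k, 0),
   and [drop k lam] lists the parts lambda_j with j > k. *)
Definition is_config (lam : seq nat) (t : nat) (eta mu : 'I_t -> nat)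
    (nu : nat -> seq nat) : Prop :=
  nu 0%N = [::] /\
  forall k : nat, (0 < k)%N ->
    is_partition (nu k) /\
    (sumn (nu k))%:Z =
      (sumn (drop k lam))%:Z - (\sum_a mu a * (eta a - k))%N%:Z.

(* P_{k,n}(nu), for k >= 1 and n >= 1. *)
Definition vacancy (t : nat) (eta mu : 'I_t -> nat) (nu : nat -> seq nat)
    (k n : nat) : int :=
  (Qn n (nu k.-1))%:Z - 2 * (Qn n (nu k))%:Z + (Qn n (nu k.+1))%:Z
  + (\sum_a minn (mu a) n * (eta a == k))%N%:Z.

Definition admissible (t : nat) (eta mu : 'I_t -> nat) (nu : nat -> seq nat) :
    Prop :=
  forall k n : nat, (0 < k)%N -> (0 < n)%N -> 0 <= vacancy eta mu nu k n.

(* The label of the part [nth 0 (nu k) s] is [nth 0 (L k) s]; the sizes are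
   required to agree so that [L] consists of these labels and nothing else. *)
Definition is_rigging (t : nat) (eta mu : 'I_t -> nat) (nu : nat -> seq nat)
    (L : nat -> seq int) : Prop :=
  (forall k : nat, size (L k) = size (nu k)) /\
  forall k s : nat, (0 < k)%N -> (s < size (nu k))%N ->
    0 <= nth 0 (L k) s <= vacancy eta mu nu k (nth 0%N (nu k) s) /\
    ((s.+1 < size (nu k))%N -> nth 0%N (nu k) s = nth 0%N (nu k) s.+1 ->
       nth 0 (L k) s.+1 <= nth 0 (L k) s).

Definition RC (lam : seq nat) (t : nat) (eta mu : 'I_t -> nat) :
    set ((nat -> seq nat) * (nat -> seq int)) :=
  [set x | [/\ is_config lam eta mu x.1, admissible eta mu x.1
             & is_rigging eta mu x.1 x.2]].

(* alpha_{k,n}, for k >= 1 and n >= 1. *)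
Definition alpha (nu : nat -> seq nat) (k n : nat) : int :=
  (nth 0%N (conjp (nu k)) n.-1)%:Z.

(* If (nu, L) is in [RC lam eta mu], then nu^k is empty for k large (it has
   size 0 as soon as k >= size lam and k >= eta_a for all a), so that the sums
   below have finite support. *)
Definition cocharge (x : (nat -> seq nat) * (nat -> seq int)) : int :=
  let: (nu, L) := x in
  \sum_(k \in [set k : nat | (0 < k)%N])
    \sum_(n \in [set n : nat | (0 < n)%N])
      alpha nu k n * (alpha nu k n - alpha nu k.+1 n)
  + \sum_(k \in [set k : nat | (0 < k)%N])
      \sum_(s < size (nu k)) nth 0 (L k) s.

(* The set [RC lam eta mu] is finite: all but finitely many nu^k are empty, the
   sizes of the others are prescribed, and the labels are bounded. The
   polynomial is evaluated at an element q of a field; the indeterminate is the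
   case of q = 'X in the fraction field of a polynomial ring. *)
Definition RCgf (F : fieldType) (lam : seq nat) (t : nat)
    (eta mu : 'I_t -> nat) (q : F) : F :=
  \sum_(x \in RC lam eta mu) q ^ cocharge x.

(* Main.v *)
(* Put m_{k,n} = alpha_{k-1,n} - alpha_{k,n} + r_{k,n}(R). Its row sums are the
   lambda_k, and P_{k,n} = S_{k,n} - S_{k+1,n} where S_{k,n} = m_{k,1} + ... + m_{k,n}.
   The transposed configuration nu' has the matrix
   m'_{n,k} = [n <= lambda_k] + r_{k,n}(R) - m_{k,n}; in other words
   alpha'_{n,k} = S_{k,n} - min(lambda_k, n).

   If nu is admissible, then by descending induction on k the vacancy number
   P_{k+1,n} is, for n >= lambda_{k+2}, a concave nondecreasing integer sequence
   with limit lambda_{k+1} - lambda_{k+2}. Hence the parts of nu^k are at most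
   lambda_{k+1}, and P_{k,n} >= min(lambda_k, n) - min(lambda_{k+1}, n), so that
   alpha'_{n,k} is nonincreasing in k. The difference of the two sides is the
   multiplicity of k in nu'^n; it equals P_{k,n} when n is a part of nu^k. The
   labels of the parts n of nu^k form a partition in a box whose sides are the
   multiplicity of n and P_{k,n}; they are replaced by the transposed complement.

   The quadratic part of the cocharge is (1/2) sum (m - r)^2 for nu and
   (1/2) sum (m - [n <= lambda_k])^2 for nu', and the areas of the boxes add up to
   sum (r - m) m. As sum m [n <= lambda_k] = |lambda| = sum r, the total is n(R). *)
Require Import Defs.
From mathcomp Require Import all_boot all_order all_algebra.
From mathcomp Require Import boolp classical_sets functions fsbigop.
From mathcomp Require Import zify ring.

Set Implicit Arguments.
Unset Strict Implicit.
Unset Printing Implicit Defensive.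

Import Order.TTheory GRing.Theory Num.Theory.
Local Open Scope ring_scope.

(** * Columns of a partition and conjugation *)

(* The length of the column of [rho] of index [n], counted from 0. *)
Definition ncol (rho : seq nat) (n : nat) : nat := count (fun x => (n < x)%N) rho.

Lemma eq_from_ltn (a b : nat) : (forall i, (i < a)%N = (i < b)%N) -> a = b.
Proof. by move=> H; have := H a; have := H b; lia. Qed.

Lemma ncol_anti rho i j : (i <= j)%N -> (ncol rho j <= ncol rho i)%N.
Proof. by move=> ij; apply: sub_count => x /=; lia. Qed.

(** Both sides say that the cell in row s and column n lies in the diagram of [rho]: sortedness puts
    the rows longer than n first. The facts on conjugation below rest on this equivalence. *)
Lemma ltn_ncol rho n s :
  sorted geq rho -> (s < ncol rho n)%N = (n < nth 0%N rho s)%N.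
Proof.
elim: rho s => [|x r IH] s /=; first by rewrite nth_nil.
rewrite (path_sortedE (rev_trans leq_trans)) => /andP[/allP xr sr].
have small: (x <= n)%N -> ncol r n = 0%N.
  move=> xn; apply/eqP; rewrite -leqn0 leqNgt -has_count; apply/hasPn => y yr.
  by have := xr y yr; rewrite /=; lia.
rewrite /ncol /= -/(ncol r n).
case: s => [|s] /=; first by case: (ltnP n x) => // /small ->.
case: (ltnP n x) => [_|xn]; first by rewrite add1n ltnS IH.
rewrite (small xn) /=; case: (ltnP s (size r)) => sr'; last by rewrite nth_default.
by have := xr _ (mem_nth 0%N sr'); rewrite /=; lia.
Qed.

Lemma ncol0 rho : 0%N \notin rho -> ncol rho 0 = size rho.
Proof.
move=> h; apply/eqP; rewrite -all_count; apply/allP => x xr.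
by case: x xr h => // ->.
Qed.

Lemma nth_conjp rho n : sorted geq rho -> nth 0%N (conjp rho) n = ncol rho n.
Proof.
move=> sr; rewrite /conjp -nth0.
case: (ltnP n (nth 0%N rho 0)) => h; first by rewrite nth_mkseq.
rewrite nth_default ?size_mkseq //.
by have := ltn_ncol n 0 sr; lia.
Qed.

Lemma is_partition_conjp rho : sorted geq rho -> is_partition (conjp rho).
Proof.
move=> sr; apply/andP; split.
  apply: (@homo_sorted_in _ _ xpredT (fun j => ncol rho j) leq geq) => //.
  - by move=> i j _ _ ij; apply: ncol_anti.
  - by apply/allP.
  - exact: iota_sorted.
apply/negP => /mapP[j]; rewrite mem_iota /= add0n -nth0 => jl.
by have := ltn_ncol j 0 sr; rewrite jl /ncol; lia.
Qed.

Lemma ncol_conjp rho n : sorted geq rho -> ncol (conjp rho) n = nth 0%N rho n.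
Proof.
move=> sr; apply: eq_from_ltn => i; rewrite ltn_ncol; last first.
  by case/andP: (is_partition_conjp sr).
by rewrite nth_conjp // ltn_ncol.
Qed.

Lemma partition_eq rho sigma : is_partition rho -> is_partition sigma ->
  ncol rho =1 ncol sigma -> rho = sigma.
Proof.
move=> /andP[sr r0] /andP[ss s0] H.
apply: (@eq_from_nth _ 0%N); first by rewrite -!ncol0.
by move=> i _; apply: eq_from_ltn => j; rewrite -!ltn_ncol // H.
Qed.

Lemma conjpK rho : is_partition rho -> conjp (conjp rho) = rho.
Proof.
move=> pr; have /andP[sr _] := pr; have pc := is_partition_conjp sr.
have /andP[sc _] := pc.
apply: partition_eq => //; first exact: is_partition_conjp.
by move=> n; rewrite ncol_conjp // nth_conjp.
Qed.

Lemma Qn_ncol n rho : sorted geq rho -> Qn n rho = (\sum_(j < n) ncol rho j)%N.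
Proof. by move=> sr; apply: eq_bigr => j _; rewrite nth_conjp. Qed.

Lemma sum_ltn_nat (n x : nat) : (\sum_(j < n) (j < x))%N = minn x n.
Proof. by elim: n => [|n IH]; rewrite ?big_ord0 ?big_ord_recr /= ?IH; lia. Qed.

Lemma sumn_ncol n rho : ncol rho n = 0%N -> sumn rho = (\sum_(j < n) ncol rho j)%N.
Proof.
elim: rho => [|x r IH] /=; first by rewrite big1.
rewrite /ncol /= -/(ncol r n) => h.
rewrite big_split /= sum_ltn_nat -IH; lia.
Qed.

Lemma sumn_nth rho N : (size rho <= N)%N ->
  sumn rho = (\sum_(j < N) nth 0%N rho j)%N.
Proof.
elim: rho N => [|x r IH] N /=; first by rewrite big1 // => i _; rewrite nth_nil.
by case: N => // N; rewrite ltnS big_ord_recl /= => /IH ->.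
Qed.

Lemma ncol_size rho n : (ncol rho n <= size rho)%N.
Proof. exact: count_size. Qed.

Lemma ncol_head rho : sorted geq rho -> ncol rho (head 0%N rho) = 0%N.
Proof. by move=> sr; have := ltn_ncol (head 0%N rho) 0 sr; rewrite nth0; lia. Qed.

(** The parts equal to n + 1 occupy the positions from [ncol rho n.+1] up to, but excluding,
    [ncol rho n]. Cutting the sum into these blocks suits riggings, whose labels are compared only
    within a block. *)
Lemma sum_parts (rho : seq nat) N (f : nat -> int) :
    sorted geq rho -> 0%N \notin rho -> ncol rho N = 0%N ->
  \sum_(s < size rho) f s =
  \sum_(n < N) \sum_(i < ncol rho n - ncol rho n.+1) f (ncol rho n.+1 + i)%N.
Proof.
move=> sr r0 rN.
have -> : \sum_(s < size rho) f s = \sum_(ncol rho N <= s < ncol rho 0) f s.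
  by rewrite rN big_mkord ncol0.
elim: N {rN} => [|N IH]; first by rewrite big_geq // big_ord0.
rewrite big_ord_recr /= -IH addrC.
rewrite (big_cat_nat (n := ncol rho N)) ?ncol_anti //=.
congr (_ + _).
rewrite -{1}(add0n (ncol rho N.+1)) big_addn big_mkord.
by apply: eq_bigr => i _; rewrite addnC.
Qed.

Lemma nth_block rho n i : sorted geq rho -> (i < ncol rho n - ncol rho n.+1)%N ->
  nth 0%N rho (ncol rho n.+1 + i) = n.+1.
Proof.
move=> sr h.
have := ltn_ncol n (ncol rho n.+1 + i) sr.
have := ltn_ncol n.+1 (ncol rho n.+1 + i) sr; lia.
Qed.

Lemma blockP rho s : sorted geq rho -> 0%N \notin rho -> (s < size rho)%N ->
  exists n i, [/\ nth 0%N rho s = n.+1, (i < ncol rho n - ncol rho n.+1)%N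
    & s = (ncol rho n.+1 + i)%N].
Proof.
move=> sr r0 ss; have := ncol0 r0; have := ltn_ncol 0 s sr => h1 h2.
exists (nth 0%N rho s).-1, (s - ncol rho (nth 0%N rho s))%N.
have h3 := ltn_ncol (nth 0%N rho s) s sr.
have h4 := ltn_ncol (nth 0%N rho s).-1 s sr.
have E : (nth 0%N rho s).-1.+1 = nth 0%N rho s by rewrite prednK // -h1 h2.
by split; rewrite ?E; lia.
Qed.

Lemma fsum_pos (f : nat -> int) N : (forall k, (N <= k)%N -> f k.+1 = 0) ->
  \sum_(k \in [set k : nat | (0 < k)%N]%classic) f k = \sum_(k < N) f k.+1.
Proof.
move=> H; rewrite (@fsbigE _ _ _ _ _ (iota 1 N)) ?iota_uniq //.
- rewrite big_mkcond /= -[1%N]addn0 iotaDl big_map -{1}(subn0 N).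
  rewrite -/(index_iota 0 N) big_mkord; apply: eq_bigr => i _.
  by rewrite mem_set.
- by move=> i /=; rewrite mem_iota; lia.
- move=> [|i] //= _; rewrite mem_iota => h; apply: H; lia.
Qed.

(** * The parts of an admissible configuration *)

(** By concavity a zero increment past a makes all later increments zero, so g is then at its limit
    b - a. Until that happens g grows by at least 1 at each step, which gives g (a + i) >= i and
    forces the limit to be reached at b. *)
Lemma concave_bound (g : nat -> int) (a b N : nat) :
    (a <= b)%N -> 0 <= g a ->
    (forall n, (a <= n)%N -> 0 <= g n.+1 - g n) ->
    (forall n, (a <= n)%N -> g n.+2 - g n.+1 <= g n.+1 - g n) ->
    (forall n, (N <= n)%N -> g n = b%:Z - a%:Z) ->
  (forall n, (b <= n)%N -> g n = b%:Z - a%:Z) /\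
  (forall n, (a <= n <= b)%N -> n%:Z - a%:Z <= g n).
Proof.
move=> ab ga up conc lim.
have mono i n : (a <= n)%N -> g n <= g (n + i)%N.
  move=> an; elim: i => [|i IH]; first by rewrite addn0.
  by have := up (n + i)%N; rewrite addnS; lia.
have le_lim n : (a <= n)%N -> g n <= b%:Z - a%:Z.
  by move=> an; rewrite -(lim (n + N)%N) ?mono //; lia.
have flat n : (a <= n)%N -> g n.+1 = g n -> g n = b%:Z - a%:Z.
  move=> an fl.
  have step i : g (n + i).+1 = g (n + i)%N.
    elim: i => [|i IH]; first by rewrite addn0.
    by have := conc (n + i)%N; have := up (n + i).+1; rewrite !addnS; lia.
  have const i : g (n + i)%N = g n.
    by elim: i => [|i IH]; rewrite ?addn0 // addnS step.
  by rewrite -(const N) lim //; lia.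
have low i : (a + i <= b)%N -> i%:Z <= g (a + i)%N.
  elim: i => [|i IH]; first by rewrite addn0.
  move=> aib; have := up (a + i)%N; have := flat (a + i)%N; have := IH; rewrite addnS.
  by have := mono 1%N (a + i)%N; rewrite addn1; lia.
have gb : g b = b%:Z - a%:Z.
  by have := low (b - a)%N; have := le_lim b; rewrite subnKC //; lia.
split=> n h.
  by have := mono (n - b)%N b; have := le_lim n; rewrite subnKC // gb; lia.
by have := low (n - a)%N; rewrite subnKC; lia.
Qed.

(* S_{k+1,n}, with S as at the top of the file: rows are counted from 0. *)
Definition row_sum (t : nat) (eta mu : 'I_t -> nat) (nu : nat -> seq nat)
    (k n : nat) : int :=
  (Qn n (nu k))%:Z - (Qn n (nu k.+1))%:Z
  + (\sum_a (k < eta a) * minn (mu a) n)%N%:Z.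

(** This is r_{k+1,n+1}(R), written as a sum so that it appears directly as an increment of the
    rectangle term of [row_sum]. *)
Definition cell_mult (t : nat) (eta mu : 'I_t -> nat) (k n : nat) : nat :=
  (\sum_a (k < eta a) * (n < mu a))%N.

Lemma nth_part_le lam k : is_partition lam -> (nth 0%N lam k.+1 <= nth 0%N lam k)%N.
Proof.
case/andP=> sl _.
have := ltn_ncol (nth 0%N lam k) k sl; have := ltn_ncol (nth 0%N lam k) k.+1 sl.
lia.
Qed.

Lemma nth_part_anti lam i j :
  is_partition lam -> (i <= j)%N -> (nth 0%N lam j <= nth 0%N lam i)%N.
Proof.
move=> hlam /subnKC <-; elim: (j - i)%N => [|d IH]; first by rewrite addn0.
by rewrite addnS; apply: leq_trans IH; apply: nth_part_le.
Qed.

Lemma row_sum0 t (eta mu : 'I_t -> nat) nu k : row_sum eta mu nu k 0 = 0.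
Proof. by rewrite /row_sum /Qn !big_ord0 big1 // => a _; rewrite minn0 muln0. Qed.

Lemma vacancyE t (eta mu : 'I_t -> nat) nu k n :
  vacancy eta mu nu k.+1 n = row_sum eta mu nu k n - row_sum eta mu nu k.+1 n.
Proof.
rewrite /vacancy /row_sum /=.
have -> : (\sum_a (k < eta a) * minn (mu a) n)%N =
   (\sum_a minn (mu a) n * (eta a == k.+1) + \sum_a (k.+1 < eta a) * minn (mu a) n)%N.
  rewrite -big_split /=; apply: eq_bigr => a _.
  by case: (ltngtP (eta a) k.+1) => h; lia.
rewrite !PoszD; ring.
Qed.

Section AdmissibleConfig.

Variables (lam : seq nat) (t : nat) (eta mu : 'I_t -> nat) (nu : nat -> seq nat).
Hypothesis hlam : is_partition lam.
Hypothesis hsize : sumn lam = (\sum_a eta a * mu a)%N.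
Hypothesis conf : is_config lam eta mu nu.

Local Notation l := (nth 0%N lam).
Local Notation S := (row_sum eta mu nu).
Local Notation x k n := (ncol (nu k) n).

Lemma config_part k : is_partition (nu k).
Proof. by case: k => [|k]; [rewrite conf.1 | case: (conf.2 k.+1 isT)]. Qed.

Lemma config_sorted k : sorted geq (nu k).
Proof. by case/andP: (config_part k). Qed.

Lemma config_no0 k : 0%N \notin nu k.
Proof. by case/andP: (config_part k). Qed.

(** For k = 0 this is the equality of |lambda| with the total size of the rectangles, so the first
    row needs no separate treatment later. *)
Lemma config_size k :
  (sumn (nu k))%:Z = (sumn (drop k lam))%:Z - (\sum_a mu a * (eta a - k))%N%:Z.
Proof.
clear hlam.
case: k => [|k]; last by case: (conf.2 k.+1 isT).
rewrite conf.1 drop0 hsize.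
by under [X in _ - Posz X]eq_bigr => a _ do rewrite subn0 mulnC; rewrite subrr.
Qed.

Lemma config_ncol0 n : x 0 n = 0%N.
Proof. by rewrite conf.1. Qed.

Lemma row_sumS k n :
  S k n.+1 = S k n + (x k n)%:Z - (x k.+1 n)%:Z + (cell_mult eta mu k n)%:Z.
Proof.
clear hlam hsize.
rewrite /row_sum !Qn_ncol ?config_sorted // !big_ord_recr /=.
have -> : (\sum_a (k < eta a) * minn (mu a) n.+1)%N =
   (\sum_a (k < eta a) * minn (mu a) n + cell_mult eta mu k n)%N.
  by rewrite -big_split /=; apply: eq_bigr => a _; rewrite -mulnDr; congr (_ * _)%N; lia.
rewrite !PoszD; ring.
Qed.

(** Past the last row of lambda, the size of nu^k is minus a natural number, so both vanish; in
    particular a rectangle with more than k rows has width 0. *)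
Lemma config_large k : (size lam <= k)%N ->
  nu k = [::] /\ forall a, (mu a * (eta a - k))%N = 0%N.
Proof.
clear hlam.
move=> lk; have := config_size k; rewrite drop_oversize //= => h.
have [h1 h2] : sumn (nu k) = 0%N /\ (\sum_a mu a * (eta a - k))%N = 0%N.
  by move: h; set u := (\sum_a _)%N; lia.
split.
  apply: partition_eq => //; first exact: config_part.
  have /eqP := h1; rewrite sumnE sum_nat_seq_eq0 => /allP z.
  case E : (nu k) (config_no0 k) z => [//|y r] /negP n0 z.
  by case: n0; have := z y (mem_head _ _); rewrite /= => /eqP <-; apply: mem_head.
move=> a; have /eqP := h2.
by rewrite sum_nat_eq0 => /forallP /(_ a) /implyP /(_ isT) /eqP.
Qed.

(** Once n passes all parts of nu^k and nu^{k+1} and all widths, each Q_n is the full size of its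
    partition, and the type prescribes the difference of the sizes. *)
Lemma row_sum_lim k : exists N, forall n, (N <= n)%N -> S k n = (l k)%:Z.
Proof.
clear hlam.
exists (head 0 (nu k) + head 0 (nu k.+1) + \max_a mu a)%N => n hn.
have Qlim j : (head 0 (nu j) <= n)%N -> Qn n (nu j) = sumn (nu j).
  move=> hj; rewrite Qn_ncol ?config_sorted // (@sumn_ncol n) //; apply/eqP.
  by rewrite -leqn0 -(ncol_head (config_sorted j)) ncol_anti.
rewrite /row_sum !Qlim; try lia.
rewrite !config_size.
have -> : (\sum_a (k < eta a) * minn (mu a) n)%N%:Z =
  (\sum_a mu a * (eta a - k))%N%:Z - (\sum_a mu a * (eta a - k.+1))%N%:Z :> int.
  rewrite [in X in _ = X - _](_ : (\sum_a mu a * (eta a - k) =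
     \sum_a (k < eta a) * minn (mu a) n + \sum_a mu a * (eta a - k.+1))%N); first by lia.
  rewrite -big_split /=; apply: eq_bigr => a _.
  have := leq_bigmax (F := mu) a => ?; case: (ltnP k (eta a)) => h; last first.
    have -> : (eta a - k = 0)%N by lia.
    have -> : (eta a - k.+1 = 0)%N by lia.
    by rewrite muln0.
  have -> : (eta a - k = (eta a - k.+1).+1)%N by lia.
  have -> : minn (mu a) n = mu a by lia.
  by rewrite mulnS mul1n.
have -> : sumn (drop k lam) = (l k + sumn (drop k.+1 lam))%N.
  case: (ltnP k (size lam)) => h; first by rewrite (drop_nth 0%N h).
  by rewrite !drop_oversize ?nth_default //; lia.
lia.
Qed.

Hypothesis adm : admissible eta mu nu.

Lemma row_sum_anti k n : S k.+1 n <= S k n.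
Proof.
case: n => [|n]; first by rewrite !row_sum0.
by have := adm (ltn0Sn k) (ltn0Sn n); rewrite vacancyE; lia.
Qed.

(* For n >= lambda_{k+2} the increment of P_{k+1,n} is [x k n + e n], since the
   parts of nu^(k+1) and nu^(k+2) are at most lambda_{k+2}. *)
Lemma vacancy_growth k :
  (forall n, (l k.+1 <= n)%N -> x k.+1 n = 0%N) ->
  (forall n, (l k.+2 <= n)%N -> x k.+2 n = 0%N) ->
  [/\ forall n, (l k <= n)%N -> x k n = 0%N,
      forall a n, eta a = k.+1 -> (l k <= n)%N -> (mu a <= n)%N &
      forall n, (minn (l k) n)%:Z - (minn (l k.+1) n)%:Z <= S k n - S k.+1 n].
Proof.
move=> x1 x2.
pose p n : int := S k n - S k.+1 n.
pose e n : nat := (\sum_a (eta a == k.+1) * (n < mu a))%N.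
have pS n : (l k.+1 <= n)%N -> p n.+1 = p n + (x k n)%:Z + (e n)%:Z.
  move=> hn; have := nth_part_le k.+1 hlam; rewrite /p !row_sumS => ?.
  rewrite x1 // x2; last by lia.
  have -> : cell_mult eta mu k n = (cell_mult eta mu k.+1 n + e n)%N.
    rewrite /cell_mult -big_split /=; apply: eq_bigr => a _.
    by rewrite -mulnDl; congr (_ * _)%N; lia.
  by lia.
have e_anti n : (e n.+1 <= e n)%N.
  by apply: leq_sum => a _; rewrite leq_mul2l; lia.
have [N1 lim1] := row_sum_lim k; have [N2 lim2] := row_sum_lim k.+1.
have [|n hn|n hn|n hn|eqp lep] :=
  @concave_bound p (l k.+1) (l k) (N1 + N2) (nth_part_le k hlam).
- by have := row_sum_anti k (l k.+1); rewrite /p; lia.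
- by rewrite pS //; lia.
- rewrite !pS //; try lia.
  by have := e_anti n; have := ncol_anti (nu k) (leqnSn n); lia.
- by rewrite /p lim1 ?lim2 //; lia.
(* From [l k] on the vacancy number is constant, so its increment is 0; the increment is a sum of
   two natural numbers, which vanish separately. *)
have z n : (l k <= n)%N -> (x k n + e n = 0)%N.
  move=> hn; have := pS n; rewrite !eqp //; try lia.
  by have := nth_part_le k hlam; lia.
split=> [n hn|a n ea hn|n].
- by have := z n hn; lia.
- have := z n hn; rewrite /e (bigD1 a) //= ea eqxx; lia.
- have := row_sum_anti k n; have := lep n; have := eqp n; have := nth_part_le k hlam.
  rewrite /p; lia.
Qed.

(** Descending induction on k, run as an induction on j with [size lam <= k + j]; [vacancy_growth]
    asks for the two following indices, both covered by the induction hypothesis. *)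
Lemma ncol_config k n : (l k <= n)%N -> x k n = 0%N.
Proof.
have H j : forall k, (size lam <= k + j)%N ->
   forall n, (l k <= n)%N -> x k n = 0%N.
  elim: j => [|j IH] {}k hk; first by rewrite addn0 in hk; rewrite (config_large hk).1.
  by case: (@vacancy_growth k) => //; apply: IH; lia.
by apply: (H (size lam)); lia.
Qed.

(** The width is bounded at the last row that the rectangle meets, of index [(eta a).-1]; row k of
    lambda is at least as long as that one. *)
Lemma rect_config a k n : (k < eta a)%N -> (l k <= n)%N -> (mu a <= n)%N.
Proof.
move=> ka hn; have [//||_ H _] := @vacancy_growth (eta a).-1.
- by move=> m; apply: ncol_config.
- by move=> m; apply: ncol_config.
apply: (H a n); first by lia.
by apply: leq_trans hn; apply: nth_part_anti => //; lia.
Qed.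

Lemma vacancy_bound k n :
  (minn (l k) n)%:Z - (minn (l k.+1) n)%:Z <= S k n - S k.+1 n.
Proof.
by have [||_ _ H] := @vacancy_growth k; [exact: ncol_config..|exact: H].
Qed.

Lemma cell_mult_config k n : (l k <= n)%N -> cell_mult eta mu k n = 0%N.
Proof.
move=> hn; rewrite /cell_mult big1 // => a _.
by case: (ltnP k (eta a)) => // h; have := rect_config h hn; lia.
Qed.

Lemma row_sumE k n : (l k <= n)%N -> S k n = (l k)%:Z.
Proof.
move=> hn; have [N lim] := row_sum_lim k.
rewrite -(lim (n + N)%N); last by lia.
elim: N {lim} => [|N IH]; first by rewrite addn0.
rewrite addnS row_sumS -IH !ncol_config ?cell_mult_config; try lia.
by have := nth_part_le k hlam; lia.
Qed.

End AdmissibleConfig.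

(** * The transposed configuration *)

Lemma ncol_sum rho n : ncol rho n = (\sum_(k < size rho) (n < nth 0%N rho k))%N.
Proof.
elim: rho => [|y r IH]; first by rewrite big_ord0.
by rewrite big_ord_recl /= -IH.
Qed.

Lemma sumn_dropS s k : sumn (drop k s) = (nth 0%N s k + sumn (drop k.+1 s))%N.
Proof.
case: (ltnP k (size s)) => h; first by rewrite (drop_nth 0%N h).
by rewrite !drop_oversize ?nth_default //; lia.
Qed.

Lemma sumn_drop s n : (sumn (drop n s) + \sum_(j < n) nth 0%N s j)%N = sumn s.
Proof.
elim: n => [|n IH]; first by rewrite big_ord0 drop0 addn0.
by rewrite -IH big_ord_recr /= (sumn_dropS s n); lia.
Qed.

Lemma sumn_conjp s : sorted geq s -> sumn (conjp s) = sumn s.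
Proof.
move=> ss; rewrite (sumn_ncol (ncol_head ss)) (@sumn_nth _ (head 0%N s)) ?size_mkseq //.
by apply: eq_bigr => j _; rewrite nth_conjp.
Qed.

(** The cells of s are split into those of the first n columns, counted by rows, and those of the
    remaining columns. *)
Lemma sumn_drop_conjp s n : sorted geq s ->
  (sumn (drop n (conjp s)) + \sum_(k < size s) minn (nth 0%N s k) n)%N = sumn s.
Proof.
move=> ss; rewrite -(sumn_conjp ss) -(sumn_drop (conjp s) n); congr (_ + _)%N.
under [RHS]eq_bigr => j _ do rewrite nth_conjp // ncol_sum.
by rewrite exchange_big /=; apply: eq_bigr => k _; rewrite sum_ltn_nat.
Qed.

(** The list holds the prescribed column lengths of nu'^n, and [conjp] turns it into the partition.
    The absolute value is only a passage to nat: the difference is nonnegative when nu is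
    admissible, by [minn_row_sum]. *)
Definition transpose_config (lam : seq nat) (t : nat) (eta mu : 'I_t -> nat)
    (nu : nat -> seq nat) (n : nat) : seq nat :=
  conjp (mkseq (fun k => `|row_sum eta mu nu k n - (minn (nth 0%N lam k) n)%:Z|%N)
               (size lam)).

Section TransposeConfig.

Variables (lam : seq nat) (t : nat) (eta mu : 'I_t -> nat) (nu : nat -> seq nat).
Hypothesis hlam : is_partition lam.
Hypothesis hsize : sumn lam = (\sum_a eta a * mu a)%N.
Hypothesis conf : is_config lam eta mu nu.
Hypothesis adm : admissible eta mu nu.

Local Notation l := (nth 0%N lam).
Local Notation S := (row_sum eta mu nu).
Local Notation x k n := (ncol (nu k) n).
Local Notation nu' := (transpose_config lam eta mu nu).

Let lam_sorted : sorted geq lam. Proof. by case/andP: hlam. Qed.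

Lemma row_sum_large k n : (size lam <= k)%N -> S k n = 0.
Proof.
by move=> h; rewrite (row_sumE hlam hsize conf adm) nth_default.
Qed.

(** By [vacancy_bound] the difference of the two sides does not increase with k, and it is 0 past
    the rows of lambda. *)
Lemma minn_row_sum k n : (minn (l k) n)%:Z <= S k n.
Proof.
have H j : forall k, (size lam <= k + j)%N -> (minn (l k) n)%:Z <= S k n.
  elim: j => [|j IH] {}k hk.
    by rewrite row_sum_large ?nth_default ?min0n //; lia.
  by have := IH k.+1; have := vacancy_bound hlam hsize conf adm k n; lia.
by apply: (H (size lam)); lia.
Qed.

Let col n := mkseq (fun k => `|S k n - (minn (l k) n)%:Z|%N) (size lam).

Let nth_col n k : (nth 0%N (col n) k)%:Z = S k n - (minn (l k) n)%:Z.
Proof.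
have := minn_row_sum k n; case: (ltnP k (size lam)) => h; last first.
  by rewrite row_sum_large // !nth_default ?size_mkseq // min0n.
by rewrite nth_mkseq // => ?; lia.
Qed.

Let col_sorted n : sorted geq (col n).
Proof.
apply/(sortedP 0%N) => k _ /=.
have := nth_col n k; have := nth_col n k.+1.
by have := vacancy_bound hlam hsize conf adm k n; lia.
Qed.

Lemma transpose_config_part n : is_partition (nu' n).
Proof. exact: is_partition_conjp (col_sorted n). Qed.

Lemma ncol_transpose n k : (ncol (nu' n) k)%:Z = S k n - (minn (l k) n)%:Z.
Proof. by rewrite -nth_col -(ncol_conjp _ (col_sorted n)). Qed.

Lemma transpose_config0 : nu' 0 = [::].
Proof.
apply: partition_eq => // [|k]; first exact: transpose_config_part.
by have := ncol_transpose 0 k; rewrite row_sum0 minn0 /= => ?; apply/eqP; lia.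
Qed.

(** The terms in Q_n telescope; the other term counts the cells of the rectangles in the first K
    rows and n columns. *)
Lemma sum_row_sum K n : \sum_(k < K) S k n =
  - (Qn n (nu K))%:Z + (\sum_a minn (eta a) K * minn (mu a) n)%N%:Z.
Proof.
elim: K => [|K IH].
  by rewrite big_ord0 conf.1 big1 ?Qn_ncol // ?big1 // => a; rewrite minn0.
rewrite big_ord_recr /= IH /row_sum.
have -> : (\sum_a minn (eta a) K.+1 * minn (mu a) n =
   \sum_a minn (eta a) K * minn (mu a) n + \sum_a (K < eta a) * minn (mu a) n)%N.
  by rewrite -big_split /=; apply: eq_bigr => a _; rewrite -mulnDl; congr (_ * _)%N; lia.
rewrite PoszD; ring.
Qed.

(** The size of nu'^n is the number of cells of R minus that of lambda in the first n columns. The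
    totals being equal, this is the number of cells of lambda minus that of R in the later
    columns. *)
Lemma transpose_config_type : is_config (conjp lam) mu eta nu'.
Proof.
split=> [|n _]; first exact: transpose_config0.
split; first exact: transpose_config_part.
have [nuK rectK] := config_large hsize conf (leqnn (size lam)).
rewrite (@sumn_ncol (size lam)); last first.
  have := ncol_transpose n (size lam).
  by rewrite row_sum_large // nth_default // min0n => ?; apply/eqP; lia.
rewrite -natz natr_sum.
under eq_bigr => k _ do rewrite natz ncol_transpose.
rewrite sumrB sum_row_sum nuK.
have -> : \sum_(k < size lam) (minn (l k) n)%:Z
    = (\sum_(k < size lam) minn (l k) n)%N%:Z.
  by rewrite -[RHS]natz natr_sum; apply: eq_bigr => k _; rewrite natz.
have := sumn_drop_conjp n lam_sorted.
rewrite hsize.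
have -> : (\sum_a eta a * mu a =
   \sum_a minn (eta a) (size lam) * minn (mu a) n + \sum_a eta a * (mu a - n))%N.
  rewrite -big_split /=; apply: eq_bigr => a _.
  (* A rectangle with more rows than lambda has width 0, so truncation to [size lam] rows loses no
     cell. *)
  have := rectK a; case: (leqP (eta a) (size lam)) => h.
    by move=> _; rewrite -mulnDr; congr (_ * _)%N; lia.
  have -> : (eta a - size lam = (eta a - size lam).-1.+1)%N by lia.
  rewrite mulnS => ?; have -> : mu a = 0%N by lia.
  by rewrite min0n sub0n !muln0.
have -> : Qn n [::] = 0%N by rewrite /Qn big1 // => j _; rewrite nth_nil.
set A := (\sum_a minn _ _ * _)%N; set B := (\sum_a _ * _)%N; set C := (\sum_k _)%N; lia.
Qed.

(** Induction on k; the step is the formula for m'. Compared with [ncol_transpose] for nu', it shows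
    that transposing twice restores nu; as both terms are nonincreasing in n, it also gives the
    admissibility of nu'. *)
Lemma transpose_row_sum n k :
  row_sum mu eta nu' n k = (x k n)%:Z + (minn (nth 0%N (conjp lam) n) k)%:Z.
Proof.
rewrite nth_conjp //.
elim: k => [|k IH]; first by rewrite row_sum0 minn0 (config_ncol0 conf).
rewrite (row_sumS transpose_config_type) IH !ncol_transpose (row_sumS conf).
have -> : cell_mult mu eta n k = cell_mult eta mu k n.
  by apply: eq_bigr => a _; rewrite mulnC.
have := ltn_ncol n k lam_sorted; lia.
Qed.

Lemma transpose_admissible : admissible mu eta nu'.
Proof.
move=> [|n] // k _ _; rewrite vacancyE !transpose_row_sum !nth_conjp //.
have := ncol_anti (nu k) (leqnSn n); have := ncol_anti lam (leqnSn n); lia.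
Qed.

(** A part of nu^{k+1} larger than n forces n < [l k.+1] <= [l k], so the two minima in
    [ncol_transpose] are both n + 1 and cancel. *)
Lemma mult_vacancy k n : (0 < x k.+1 n)%N ->
  S k n.+1 - S k.+1 n.+1 = (ncol (nu' n.+1) k)%:Z - (ncol (nu' n.+1) k.+1)%:Z.
Proof.
move=> h; rewrite !ncol_transpose; have := nth_part_le k hlam.
by case: (ltnP n (l k.+1)) => h2; [lia|rewrite (ncol_config hlam hsize conf adm h2) in h].
Qed.

End TransposeConfig.

Lemma transpose_configK lam t (eta mu : 'I_t -> nat) nu :
    is_partition lam -> sumn lam = (\sum_a eta a * mu a)%N ->
    is_config lam eta mu nu -> admissible eta mu nu ->
  transpose_config (conjp lam) mu eta (transpose_config lam eta mu nu) = nu.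
Proof.
move=> hlam hsize conf adm; have /andP[sl _] := hlam.
have hsize' : sumn (conjp lam) = (\sum_a mu a * eta a)%N.
  by rewrite sumn_conjp // hsize; apply: eq_bigr => a _; rewrite mulnC.
have hlam' := is_partition_conjp sl.
have conf' := transpose_config_type hlam hsize conf adm.
have adm' := transpose_admissible hlam hsize conf adm.
apply/funext => k; apply: partition_eq.
- exact: transpose_config_part.
- exact: config_part conf k.
move=> n; have := ncol_transpose hlam' hsize' conf' adm' k n.
by rewrite (transpose_row_sum hlam hsize conf adm); lia.
Qed.

(** * The transposed rigging *)

(* If [m' >= b 0 >= ... >= b m.-1], this is the transpose of the complement of
   the partition [b] in the m x m' box. *)
Definition box_dual (m m' : nat) (b : nat -> nat) (i : nat) : nat :=
  (\sum_(r < m) (b r < m' - i))%N.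

Lemma sum_ord_rev n (f : nat -> nat) :
  (\sum_(i < n) f (n - i) = \sum_(i < n) f i.+1)%N.
Proof.
rewrite (reindex_inj rev_ord_inj) /=; apply: eq_bigr => i _; congr f.
by have := ltn_ord i; lia.
Qed.

Lemma box_dual_le m m' b i : (box_dual m m' b i <= m)%N.
Proof.
rewrite -[X in (_ <= X)%N]card_ord -sum1_card; apply: leq_sum => r _.
by case: (_ < _)%N.
Qed.

Lemma box_dual_anti m m' b i : (box_dual m m' b i.+1 <= box_dual m m' b i)%N.
Proof. by apply: leq_sum => r _; lia. Qed.

Section BoxDual.

Variables (m m' : nat) (b : nat -> nat).
Hypothesis b_le : forall r, (r < m)%N -> (b r <= m')%N.

(** Row r of the box contributes b r cells to the first sum and the m' - b r complementary cells to
    the second. *)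
Lemma box_dual_sum :
  (\sum_(r < m) b r + \sum_(i < m') box_dual m m' b i = m * m')%N.
Proof.
rewrite exchange_big -big_split /= -[X in _ = (X * _)%N]card_ord -sum_nat_const.
apply: eq_bigr => r _; have := b_le (ltn_ord r).
rewrite (sum_ord_rev m' (fun j => (b r < j) : nat)) => br.
rewrite -{1}(minn_idPl br) -sum_ltn_nat -big_split /=.
rewrite -[RHS]card_ord -sum1_card; apply: eq_bigr => i _; lia.
Qed.

Hypothesis b_anti : forall r, (r.+1 < m)%N -> (b r.+1 <= b r)%N.

Let b_anti_le r s : (r <= s)%N -> (s < m)%N -> (b s <= b r)%N.
Proof.
move/subnKC <-; elim: (s - r)%N => [|d IH]; first by rewrite addn0.
by rewrite addnS => h; apply: leq_trans (IH _); [exact: b_anti|lia].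
Qed.

(** As b is nonincreasing, the r with b r < m' - i form a final segment of the rows; it has fewer
    than m - s elements exactly when s is outside it. *)
Lemma box_dualP s i : (s < m)%N -> (i < m')%N ->
  (box_dual m m' b i < m - s)%N = (m' - i <= b s)%N.
Proof.
move=> sm im.
have split_at k : (k <= m)%N -> box_dual m m' b i =
    (\sum_(0 <= r < k) (b r < m' - i) + \sum_(k <= r < m) (b r < m' - i))%N.
  by move=> km; rewrite -big_cat_nat //= big_mkord.
case: (leqP (m' - i) (b s)) => h.
- rewrite (split_at s.+1) // big_nat big1 ?add0n => [|r /andP[_ rs]]; last first.
    by have := b_anti_le (r := r) (s := s); lia.
  apply: (@leq_ltn_trans (\sum_(s.+1 <= r < m) 1)); last by rewrite sum_nat_const_nat; lia.
  by apply: leq_sum => r _; case: (_ < _)%N.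
- apply/negbTE; rewrite -leqNgt (split_at s); last by lia.
  apply: (@leq_trans (\sum_(s <= r < m) 1)); first by rewrite sum_nat_const_nat; lia.
  apply: leq_trans (leq_addl _ _); rewrite big_nat [X in (_ <= X)%N]big_nat.
  by apply: leq_sum => r /andP[sr rm]; have := b_anti_le sr rm; lia.
Qed.

(** By [box_dualP] the outer sum counts the i < m' with m' - i <= b s, and there are b s of them. *)
Lemma box_dualK s : (s < m)%N -> box_dual m' m (box_dual m m' b) s = b s.
Proof.
move=> sm; rewrite /box_dual -/(box_dual m m' b).
under eq_bigr => i _ do rewrite -/(box_dual m m' b i) box_dualP //.
rewrite (sum_ord_rev m' (fun j => (j <= b s) : nat)) sum_ltn_nat.
by apply/minn_idPl; apply: b_le.
Qed.

End BoxDual.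

(** The multiplicity of the part n + 1, columns being counted from 0. *)
Definition mult (rho : seq nat) (n : nat) : nat := (ncol rho n - ncol rho n.+1)%N.

(** The block of parts k + 1 in nu'^n receives the dual of the labels on the block of parts n in
    nu^{k+1}; the last argument of [box_dual] is the position inside the block. Both configurations
    are arguments, so that the inverse is obtained by exchanging them. *)
Definition transpose_rigging (nu nu' : nat -> seq nat) (L : nat -> seq int)
    (n : nat) : seq int :=
  mkseq (fun s =>
    let k := (nth 0%N (nu' n) s).-1 in
    (box_dual (mult (nu k.+1) n.-1) (mult (nu' n) k)
       (fun r => `|nth 0%R (L k.+1) (ncol (nu k.+1) n + r)|%N)
       (s - ncol (nu' n) k.+1))%:Z)
  (size (nu' n)).

Lemma nth_transpose_rigging nu nu' L n k i :
    is_partition (nu' n.+1) -> (i < mult (nu' n.+1) k)%N ->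
  nth 0 (transpose_rigging nu nu' L n.+1) (ncol (nu' n.+1) k.+1 + i) =
  (box_dual (mult (nu k.+1) n) (mult (nu' n.+1) k)
     (fun r => `|nth 0%R (L k.+1) (ncol (nu k.+1) n.+1 + r)|%N) i)%:Z.
Proof.
move=> /andP[sp p0] hi; rewrite nth_mkseq; last first.
  have := ncol_size (nu' n.+1) k; move: hi; rewrite /mult; lia.
by rewrite nth_block //= addKn.
Qed.

(** The conditions on labels are regrouped by blocks of equal parts, the form to which [box_dual]
    applies. *)
Lemma riggingP t (eta mu : 'I_t -> nat) nu L :
    (forall k, is_partition (nu k)) ->
  is_rigging eta mu nu L <->
  (forall k, size (L k) = size (nu k)) /\
  forall k n i, (i < mult (nu k.+1) n)%N ->
    0 <= nth 0 (L k.+1) (ncol (nu k.+1) n.+1 + i)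
      <= row_sum eta mu nu k n.+1 - row_sum eta mu nu k.+1 n.+1 /\
    ((i.+1 < mult (nu k.+1) n)%N ->
     nth 0 (L k.+1) (ncol (nu k.+1) n.+1 + i.+1)
       <= nth 0 (L k.+1) (ncol (nu k.+1) n.+1 + i)).
Proof.
move=> pnu; split=> -[sz H]; split=> //.
  move=> k n i hi; have /andP[sp p0] := pnu k.+1.
  have is_s j : (j < mult (nu k.+1) n)%N ->
      (ncol (nu k.+1) n.+1 + j < size (nu k.+1))%N.
    by rewrite /mult => h; have := ncol_size (nu k.+1) n; lia.
  have [] := H k.+1 (ncol (nu k.+1) n.+1 + i)%N isT (is_s i hi).
  rewrite nth_block // vacancyE => H1 H2; split=> // hi1.
  by have := H2; rewrite -addnS nth_block //; apply=> //; apply: is_s.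
move=> [//|k] s _ hs; have /andP[sp p0] := pnu k.+1.
have [n [i [En hi Es]]] := blockP sp p0 hs.
have [H1 H2] := H k n i hi; rewrite En vacancyE Es; split=> // hs1 En1.
rewrite -addnS; apply: H2; have := ltn_ncol n (ncol (nu k.+1) n.+1 + i).+1 sp.
by rewrite -En1 ltnSn /mult; lia.
Qed.

Section TransposeRigging.

Variables (lam : seq nat) (t : nat) (eta mu : 'I_t -> nat) (nu : nat -> seq nat)
  (L : nat -> seq int).
Hypothesis hlam : is_partition lam.
Hypothesis hsize : sumn lam = (\sum_a eta a * mu a)%N.
Hypothesis conf : is_config lam eta mu nu.
Hypothesis adm : admissible eta mu nu.
Hypothesis rig : is_rigging eta mu nu L.

Local Notation nu' := (transpose_config lam eta mu nu).

Let part' n : is_partition (nu' n).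
Proof. exact: transpose_config_part. Qed.

Let rigL := (riggingP eta mu L (config_part conf)).1 rig.

Local Notation lab k n r := `|nth 0%R (L k.+1) (ncol (nu k.+1) n.+1 + r)|%N.

Lemma vacancy_mult k n : (0 < mult (nu k.+1) n)%N ->
  row_sum eta mu nu k n.+1 - row_sum eta mu nu k.+1 n.+1 = (mult (nu' n.+1) k)%:Z.
Proof.
rewrite {1}/mult => h; rewrite (mult_vacancy hlam hsize conf adm); last by lia.
by rewrite /mult; have := ncol_anti (nu' n.+1) (leqnSn k); lia.
Qed.

Lemma label_le k n r : (r < mult (nu k.+1) n)%N -> (lab k n r <= mult (nu' n.+1) k)%N.
Proof.
by move=> h; have [] := rigL.2 k n r h; rewrite vacancy_mult; lia.
Qed.

Lemma label_anti k n r : (r.+1 < mult (nu k.+1) n)%N -> (lab k n r.+1 <= lab k n r)%N.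
Proof.
move=> h; have := (rigL.2 k n r (ltnW h)).2 h; have := (rigL.2 k n r.+1 h).1.
have := (rigL.2 k n r (ltnW h)).1; lia.
Qed.

Lemma transpose_rigging_block k n :
  \sum_(r < mult (nu k.+1) n) nth 0 (L k.+1) (ncol (nu k.+1) n.+1 + r) +
  \sum_(i < mult (nu' n.+1) k)
     nth 0 (transpose_rigging nu nu' L n.+1) (ncol (nu' n.+1) k.+1 + i) =
  (mult (nu k.+1) n)%:Z *
  (row_sum eta mu nu k n.+1 - row_sum eta mu nu k.+1 n.+1).
Proof.
have -> : (mult (nu k.+1) n)%:Z *
    (row_sum eta mu nu k n.+1 - row_sum eta mu nu k.+1 n.+1) =
    (mult (nu k.+1) n * mult (nu' n.+1) k)%N%:Z.
  (* If n + 1 is not a part of nu^{k+1}, the vacancy number may differ from the side of the box, but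
     both products are 0. *)
  case: (posnP (mult (nu k.+1) n)) => [->|h]; first by rewrite mul0r.
  by rewrite vacancy_mult.
rewrite -(box_dual_sum (@label_le k n)) PoszD -!natz !natr_sum.
congr (_ + _); apply: eq_bigr => i _; rewrite natz.
  by have [] := rigL.2 k n i (ltn_ord i); lia.
by rewrite nth_transpose_rigging.
Qed.

Lemma transpose_rigging_type : is_rigging mu eta nu' (transpose_rigging nu nu' L).
Proof.
apply/riggingP => //; split=> [n|n k i hi]; first by rewrite size_mkseq.
(* New labels are at most this multiplicity by [box_dual_le]; the new vacancy number exceeds it by a
   nonnegative difference of minima. *)
have lek : (mult (nu k.+1) n)%:Z <=
    row_sum mu eta nu' n k.+1 - row_sum mu eta nu' n.+1 k.+1.
  have /andP[sl _] := hlam.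
  rewrite !(transpose_row_sum hlam hsize conf adm) /mult !nth_conjp //.
  have := ncol_anti lam (leqnSn n); have := ncol_anti (nu k.+1) (leqnSn n); lia.
split=> [|hi1]; rewrite !nth_transpose_rigging ?lez_nat ?box_dual_anti //.
have := @box_dual_le (mult (nu k.+1) n) (mult (nu' n.+1) k) (fun r => lab k n r) i; lia.
Qed.

Lemma transpose_riggingK :
  transpose_rigging nu' nu (transpose_rigging nu nu' L) = L.
Proof.
apply/funext => k; apply: (@eq_from_nth _ 0).
  by rewrite size_mkseq rigL.1.
rewrite size_mkseq => s hs.
case: k hs => [|k] hs; first by rewrite conf.1 in hs.
have /andP[sp p0] := config_part conf k.+1.
have [n [i [En hi ->]]] := blockP sp p0 hs.
rewrite nth_transpose_rigging //; last exact: config_part conf k.+1.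
have -> : nth 0 (L k.+1) (ncol (nu k.+1) n.+1 + i) = (lab k n i)%:Z.
  by have [] := rigL.2 k n i hi; lia.
congr Posz.
rewrite -[RHS](@box_dualK (mult (nu k.+1) n) (mult (nu' n.+1) k)
  (fun r => lab k n r)) //.
- by apply: eq_bigr => r _; rewrite nth_transpose_rigging.
- exact: label_le.
- exact: label_anti.
Qed.

End TransposeRigging.

(** * The cocharge *)

Lemma sum_ord_stable (R : zmodType) (f : nat -> R) A B :
    (forall k, (A <= k)%N -> f k = 0) -> (forall k, (B <= k)%N -> f k = 0) ->
  \sum_(k < A) f k = \sum_(k < B) f k.
Proof.
wlog AB : A B / (A <= B)%N.
  by move=> H fA fB; case: (leqP A B) => h; [|apply/esym]; apply: H => //; lia.
move=> fA _; rewrite -(big_mkord xpredT f) -[RHS](big_mkord xpredT f).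
rewrite (big_cat_nat (n := A) _ AB) //= [X in _ + X]big_nat.
by rewrite [X in _ + X]big1 ?addr0 // => k /andP[/fA ->].
Qed.

(** In the expanded squares each a_k^2 with 0 < k < K occurs twice, and the values at the ends are
    0. The partial sums differ by the boundary term [a N.+1 ^+ 2]. *)
Lemma sum_square_steps (a : nat -> int) K :
    a 0%N = 0 -> a K = 0 -> a K.+1 = 0 ->
  2 * (\sum_(k < K) a k.+1 * (a k.+1 - a k.+2)) = \sum_(k < K) (a k - a k.+1) ^+ 2.
Proof.
move=> a0 aK aK1.
suff H N : 2 * (\sum_(k < N) a k.+1 * (a k.+1 - a k.+2)) =
           \sum_(k < N.+1) (a k - a k.+1) ^+ 2 - a N.+1 ^+ 2.
  by rewrite H big_ord_recr /= aK aK1; ring.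
elim: N => [|N IH]; first by rewrite big_ord_recr /= !big_ord0 a0; ring.
by rewrite big_ord_recr /= mulrDr IH [in RHS]big_ord_recr /=; ring.
Qed.

Lemma abel_rising (a p : nat -> int) N : p 0%N = 0 -> a N = 0 ->
  \sum_(n < N) (a n - a n.+1) * p n.+1 = \sum_(n < N) a n * (p n.+1 - p n).
Proof.
move=> p0 aN.
suff H M : \sum_(n < M) (a n - a n.+1) * p n.+1 =
           \sum_(n < M) a n * (p n.+1 - p n) - a M * p M.
  by rewrite H aN mul0r subr0.
elim: M => [|M IH]; first by rewrite !big_ord0 p0; ring.
by rewrite !big_ord_recr /= IH; ring.
Qed.

Lemma abel_falling (b p : nat -> int) K : b 0%N = 0 -> b K = 0 ->
  \sum_(k < K) b k.+1 * (p k - p k.+1) = \sum_(k < K) (b k.+1 - b k) * p k.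
Proof.
move=> b0 bK.
suff H M : \sum_(k < M) b k.+1 * (p k - p k.+1) =
           \sum_(k < M) (b k.+1 - b k) * p k - b M * p M.
  by rewrite H bK mul0r subr0.
elim: M => [|M IH]; first by rewrite !big_ord0 b0; ring.
by rewrite !big_ord_recr /= IH; ring.
Qed.

Lemma rect_multE t (eta mu : 'I_t -> nat) k n :
  rect_mult eta mu k.+1 n.+1 = cell_mult eta mu k n.
Proof.
rewrite /rect_mult -sum1_card big_mkcond; apply: eq_bigr => a _.
by rewrite inE /=; do 2 case: (_ < _)%N.
Qed.

Lemma bin2_square m : (2 * 'C(m, 2) + m = m ^ 2)%N.
Proof. by elim: m => // m IH; rewrite binS bin1; lia. Qed.

Section Cocharge.

Variables (lam : seq nat) (t : nat) (eta mu : 'I_t -> nat) (nu : nat -> seq nat).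
Hypothesis hlam : is_partition lam.
Hypothesis hsize : sumn lam = (\sum_a eta a * mu a)%N.
Hypothesis conf : is_config lam eta mu nu.
Hypothesis adm : admissible eta mu nu.

Local Notation K := (size lam).
Local Notation N := (size (conjp lam)).
Local Notation l := (nth 0%N lam).
Local Notation S := (row_sum eta mu nu).
Local Notation x k n := (ncol (nu k) n)%:Z.
Local Notation R k n := (cell_mult eta mu k n)%:Z.

Lemma part_le_size_conjp k : (l k <= N)%N.
Proof. by rewrite size_mkseq -nth0; apply: nth_part_anti. Qed.

Lemma ncol_config_rows k n : (K <= k)%N -> ncol (nu k) n = 0%N.
Proof. by move=> h; rewrite (config_large hsize conf h).1. Qed.

Lemma ncol_config_cols k n : (N <= n)%N -> ncol (nu k) n = 0%N.
Proof.
move=> h; apply: (ncol_config hlam hsize conf adm).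
exact: leq_trans (part_le_size_conjp k) h.
Qed.

(** The bounds K and N depend on lambda alone and are exchanged by conjugation, so the sums for nu
    and nu' range over the same box. *)
Lemma cochargeE L : (forall k, size (L k) = size (nu k)) ->
  cocharge (nu, L) =
  \sum_(k < K) \sum_(n < N) x k.+1 n * (x k.+1 n - x k.+2 n) +
  \sum_(k < K) \sum_(n < N) \sum_(r < mult (nu k.+1) n)
     nth 0 (L k.+1) (ncol (nu k.+1) n.+1 + r).
Proof.
move=> szL; rewrite /cocharge.
have alphaE k n : alpha nu k n.+1 = x k n.
  by rewrite /alpha nth_conjp //; apply: config_sorted conf k.
have nuK k : (K <= k)%N -> nu k.+1 = [::].
  by move=> h; rewrite (config_large hsize conf (leqW h)).1.
congr (_ + _).
- rewrite (@fsum_pos _ K) => [|k hk].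
    apply: eq_bigr => k _; rewrite (@fsum_pos _ N) => [|n hn].
      by apply: eq_bigr => n _; rewrite !alphaE.
    by rewrite !alphaE ncol_config_cols // mul0r.
  rewrite (@fsum_pos _ 0) ?big_ord0 // => n _.
  by rewrite !alphaE ncol_config_rows ?mul0r //; lia.
- rewrite (@fsum_pos _ K) => [|k hk]; last by rewrite nuK // big_ord0.
  apply: eq_bigr => k _; have /andP[sp p0] := config_part conf k.+1.
  by rewrite (@sum_parts _ N (fun s => nth 0 (L k.+1) s) sp p0) // ncol_config_cols.
Qed.

(** Doubling turns the binomial into r^2 - r. The ranges may be exchanged because r vanishes outside
    either of them, outside the K x N box by [cell_mult_config]. *)
Lemma sum_nR : 2 * (nR eta mu)%:Z =
  \sum_(k < K) \sum_(n < N) (R k n ^+ 2 - R k n).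
Proof.
have sq m : m%:Z ^+ 2 - m%:Z = 2 * 'C(m, 2)%:Z.
  by have := bin2_square m; rewrite expr2; lia.
have R0 k n : (\max_a eta a <= k)%N || (\max_a mu a <= n)%N ->
      cell_mult eta mu k n = 0%N.
  move=> h; rewrite /cell_mult big1 // => a _.
  by have := leq_bigmax (F := eta) a; have := leq_bigmax (F := mu) a; lia.
have R1 k n : (K <= k)%N || (N <= n)%N -> cell_mult eta mu k n = 0%N.
  move=> h; apply: (cell_mult_config hlam hsize conf adm).
  case/orP: h => h; first by rewrite nth_default.
  exact: leq_trans (part_le_size_conjp k) h.
have -> : nR eta mu =
    (\sum_(k < \max_a eta a) \sum_(n < \max_a mu a) 'C(cell_mult eta mu k n, 2))%N.
  rewrite /nR big_add1 big_mkord; apply: eq_bigr => k _.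
  by rewrite big_add1 big_mkord; apply: eq_bigr => n _; rewrite rect_multE.
pose c k n : int := 2 * 'C(cell_mult eta mu k n, 2)%:Z.
transitivity (\sum_(k < \max_a eta a) \sum_(n < \max_a mu a) c k n).
  rewrite -natz natr_sum mulr_sumr; apply: eq_bigr => k _.
  by rewrite natr_sum mulr_sumr; apply: eq_bigr => n _; rewrite /c -[X in _ = _ * X]natz.
transitivity (\sum_(k < K) \sum_(n < \max_a mu a) c k n).
  apply: (@sum_ord_stable _ (fun k => \sum_(n < \max_a mu a) c k n)) => k hk.
    by rewrite big1 // => n _; rewrite /c R0 ?hk.
  by rewrite big1 // => n _; rewrite /c R1 ?hk.
apply: eq_bigr => k _; transitivity (\sum_(n < N) c k n).
  apply: (@sum_ord_stable _ (c k)) => n hn; first by rewrite /c R0 ?hn ?orbT.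
  by rewrite /c R1 ?hn ?orbT.
by apply: eq_bigr => n _; rewrite sq.
Qed.

(** [M] is the matrix m and [theta] the indicator of n <= lambda_k, rows and columns being counted
    from 0. *)
Let M k n : int := S k n.+1 - S k n.
Let theta k n : int := ((n < l k)%N : nat)%:Z.

Let ME k n : M k n = x k n - x k.+1 n + R k n.
Proof. by rewrite /M (row_sumS conf); ring. Qed.

Lemma sum_row_steps k n : \sum_(j < n) M k j = S k n.
Proof.
elim: n => [|n IH]; first by rewrite big_ord0 row_sum0.
by rewrite big_ord_recr /= IH /M; ring.
Qed.

Lemma sum_theta k (f : nat -> int) :
  \sum_(n < N) theta k n * f n = \sum_(n < l k) f n.
Proof.
transitivity (\sum_(n < l k) theta k n * f n).
  apply: (@sum_ord_stable _ (fun n => theta k n * f n)) => n hn.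
    by rewrite /theta ltnNge (leq_trans (part_le_size_conjp k) hn) mul0r.
  by rewrite /theta ltnNge hn mul0r.
by apply: eq_bigr => n _; rewrite /theta ltn_ord mul1r.
Qed.

(** [theta] is idempotent and selects the first [l k] columns, so the sum is [l k] minus twice
    [S k (l k)], which is already at its limit [l k]. *)
Lemma sum_theta_row k :
  \sum_(n < N) (theta k n ^+ 2 - 2 * (theta k n * M k n)) = - (l k)%:Z.
Proof.
rewrite sumrB -mulr_sumr (sum_theta k (M k)) sum_row_steps.
rewrite (row_sumE hlam hsize conf adm) //.
have -> : \sum_(n < N) theta k n ^+ 2 = \sum_(n < N) theta k n * 1.
  by apply: eq_bigr => n _; rewrite /theta; case: (_ < _)%N.
rewrite (sum_theta k (fun=> 1)) sumr_const card_ord natz; ring.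
Qed.

(** The entries of [M] are summed in two ways: its rows sum to the parts of lambda, and in its
    columns the terms from nu telescope, leaving those of R. *)
Lemma sum_cells : \sum_(k < K) \sum_(n < N) R k n = \sum_(k < K) (l k)%:Z.
Proof.
have -> : \sum_(k < K) (l k)%:Z = \sum_(k < K) \sum_(n < N) M k n.
  apply: eq_bigr => k _; rewrite sum_row_steps (row_sumE hlam hsize conf adm) //.
  exact: part_le_size_conjp.
rewrite exchange_big [RHS]exchange_big /=; apply: eq_bigr => n _.
under [RHS]eq_bigr => k _ do rewrite ME.
rewrite big_split /= -(big_mkord xpredT (fun k => x k n - x k.+1 n)).
under eq_big_nat => k _ do rewrite -opprB.
by rewrite sumrN telescope_sumr // ncol_config_rows // (config_ncol0 conf) subrr add0r.
Qed.

Local Notation nu' := (transpose_config lam eta mu nu).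
Local Notation Y n k := (ncol (nu' n) k)%:Z.

Lemma cocharge_squares :
  2 * (\sum_(k < K) \sum_(n < N) x k.+1 n * (x k.+1 n - x k.+2 n)) =
  \sum_(k < K) \sum_(n < N) (M k n - R k n) ^+ 2.
Proof.
rewrite exchange_big [RHS]exchange_big /= mulr_sumr; apply: eq_bigr => n _.
rewrite (@sum_square_steps (fun k => x k n)) /= ?(config_ncol0 conf) ?ncol_config_rows //.
by apply: eq_bigr => k _; rewrite ME; congr (_ ^+ 2); ring.
Qed.

(** By [ncol_transpose], M - theta is the increment of Y in n, and Y vanishes at n = 0 and for n >=
    N. *)
Lemma transpose_squares :
  2 * (\sum_(n < N) \sum_(k < K) Y n.+1 k * (Y n.+1 k - Y n.+2 k)) =
  \sum_(k < K) \sum_(n < N) (M k n - theta k n) ^+ 2.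
Proof.
rewrite exchange_big /= mulr_sumr; apply: eq_bigr => k _.
have Y0 n : (N <= n)%N -> Y n k = 0.
  move=> hn; have h := leq_trans (part_le_size_conjp k) hn.
  rewrite (ncol_transpose hlam hsize conf adm) (row_sumE hlam hsize conf adm) //.
  by rewrite (minn_idPl h) subrr.
have Y00 : Y 0 k = 0 by rewrite (ncol_transpose hlam hsize conf adm) row_sum0 minn0.
rewrite (@sum_square_steps (fun n => Y n k) N Y00 (Y0 _ _) (Y0 _ _)) //.
apply: eq_bigr => n _; rewrite !(ncol_transpose hlam hsize conf adm) /M /theta.
have -> : (minn (l k) n.+1)%:Z = (minn (l k) n)%:Z + ((n < l k)%N : nat)%:Z :> int by lia.
by ring.
Qed.

(** Two Abel summations: in n the difference moves from the columns of nu to S, and in k it moves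
    from M back to the columns, where x_{k+1} - x_k = R - M. *)
Lemma sum_mult_vacancy :
  \sum_(k < K) \sum_(n < N) (mult (nu k.+1) n)%:Z * (S k n.+1 - S k.+1 n.+1) =
  \sum_(k < K) \sum_(n < N) (R k n - M k n) * M k n.
Proof.
transitivity (\sum_(k < K) \sum_(n < N) x k.+1 n * (M k n - M k.+1 n)).
  apply: eq_bigr => k _.
  transitivity (\sum_(n < N) (x k.+1 n - x k.+1 n.+1) * (S k n.+1 - S k.+1 n.+1)).
    apply: eq_bigr => n _; congr (_ * _); rewrite /mult.
    by have := ncol_anti (nu k.+1) (leqnSn n); lia.
  rewrite (@abel_rising (fun n => x k.+1 n) (fun n => S k n - S k.+1 n)).
  - by apply: eq_bigr => n _; rewrite /M; congr (_ * _); ring.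
  - by rewrite !row_sum0 subrr.
  - by rewrite ncol_config_cols.
rewrite exchange_big [RHS]exchange_big /=; apply: eq_bigr => n _.
rewrite (@abel_falling (fun k => x k n) (fun k => M k n)).
- by apply: eq_bigr => k _; congr (_ * _); rewrite ME; ring.
- by rewrite (config_ncol0 conf).
- by rewrite ncol_config_rows.
Qed.

Lemma nR_decomposition :
  \sum_(k < K) \sum_(n < N) x k.+1 n * (x k.+1 n - x k.+2 n) +
  \sum_(n < N) \sum_(k < K) Y n.+1 k * (Y n.+1 k - Y n.+2 k) +
  \sum_(k < K) \sum_(n < N) (mult (nu k.+1) n)%:Z * (S k n.+1 - S k.+1 n.+1) =
  (nR eta mu)%:Z.
Proof.
have double_inj (a b : int) : 2 * a = 2 * b -> a = b by lia.
apply: double_inj.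
rewrite !mulrDr cocharge_squares transpose_squares sum_mult_vacancy sum_nR.
rewrite mulr_sumr -!big_split /=.
(* Termwise, (m - r)^2 + (m - theta)^2 + 2 (r - m) m = r^2 + theta^2 - 2 theta m, and
   [sum_theta_row] evaluates the last two terms. *)
transitivity (\sum_(k < K)
    (\sum_(n < N) (R k n ^+ 2 - R k n) + \sum_(n < N) R k n - (l k)%:Z)).
  apply: eq_bigr => k _; rewrite -sum_theta_row mulr_sumr -!big_split /=.
  by apply: eq_bigr => n _; ring.
by rewrite big_split /= sumrN big_split /= sum_cells addrK.
Qed.

End Cocharge.

(** * The bijection on rigged configurations *)

Definition transpose_rc (lam : seq nat) (t : nat) (eta mu : 'I_t -> nat)
    (y : (nat -> seq nat) * (nat -> seq int)) :
    (nat -> seq nat) * (nat -> seq int) :=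
  let nu' := transpose_config lam eta mu y.1 in
  (nu', transpose_rigging y.1 nu' y.2).

Section TransposeRC.

Variables (lam : seq nat) (t : nat) (eta mu : 'I_t -> nat).
Hypothesis hlam : is_partition lam.
Hypothesis hsize : sumn lam = (\sum_a eta a * mu a)%N.

Lemma transpose_rc_RC y :
  RC lam eta mu y -> RC (conjp lam) mu eta (transpose_rc lam eta mu y).
Proof.
move=> [conf adm rig]; split.
- exact: transpose_config_type.
- exact: transpose_admissible.
- exact: transpose_rigging_type.
Qed.

Lemma transpose_rcK y :
  RC lam eta mu y ->
  transpose_rc (conjp lam) mu eta (transpose_rc lam eta mu y) = y.
Proof.
case: y => nu L [/= conf adm rig].
by rewrite /transpose_rc /= transpose_configK // (transpose_riggingK hlam hsize conf).
Qed.

Lemma cocharge_transpose y : RC lam eta mu y ->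
  cocharge (transpose_rc lam eta mu y) = (nR eta mu)%:Z - cocharge y.
Proof.
case: y => nu L yRC; have [conf adm rig] := yRC.
have [conf' adm' rig'] := transpose_rc_RC yRC.
have /andP[sl _] := hlam.
have hsize' : sumn (conjp lam) = (\sum_a mu a * eta a)%N.
  by rewrite sumn_conjp // hsize; apply: eq_bigr => a _; rewrite mulnC.
rewrite [transpose_rc _ _ _ _]surjective_pairing.
rewrite (cochargeE (is_partition_conjp sl) hsize' conf' adm' rig'.1).
rewrite (cochargeE hlam hsize conf adm rig.1) conjpK //.
rewrite -(nR_decomposition hlam hsize conf adm).
(* The boxes are filled by the two riggings together: block (k, n) of nu is paired with block (n, k)
   of nu'. *)
have -> : \sum_(k < size lam) \sum_(n < size (conjp lam)) (mult (nu k.+1) n)%:Z *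
    (row_sum eta mu nu k n.+1 - row_sum eta mu nu k.+1 n.+1) =
  \sum_(k < size lam) \sum_(n < size (conjp lam)) \sum_(r < mult (nu k.+1) n)
     nth 0 (L k.+1) (ncol (nu k.+1) n.+1 + r) +
  \sum_(n < size (conjp lam)) \sum_(k < size lam)
     \sum_(r < mult (transpose_config lam eta mu nu n.+1) k)
     nth 0 (transpose_rigging nu (transpose_config lam eta mu nu) L n.+1)
       (ncol (transpose_config lam eta mu nu n.+1) k.+1 + r).
  rewrite [X in _ = _ + X]exchange_big -big_split /=; apply: eq_bigr => k _.
  rewrite -big_split /=; apply: eq_bigr => n _.
  by rewrite (transpose_rigging_block hlam hsize conf adm rig).
by ring.
Qed.

End TransposeRC.

Theorem proposition11 (F : fieldType) (q : F) (hq : q != 0)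
    (lam : seq nat) (hlam : is_partition lam)
    (t : nat) (eta mu : 'I_t -> nat)
    (hsize : sumn lam = (\sum_a eta a * mu a)%N) :
  RCgf (conjp lam) mu eta q = q ^+ nR eta mu * RCgf lam eta mu q^-1.
Proof.
have /andP[sl _] := hlam.
have hsize' : sumn (conjp lam) = (\sum_a mu a * eta a)%N.
  by rewrite sumn_conjp // hsize; apply: eq_bigr => a _; rewrite mulnC.
have hlam' := is_partition_conjp sl.
have bij : set_bij (RC lam eta mu) (RC (conjp lam) mu eta) (transpose_rc lam eta mu).
  split.
  - by move=> y; apply: transpose_rc_RC.
  - move=> y z /set_mem yRC /set_mem zRC e.
    by rewrite -(transpose_rcK hlam hsize yRC) e transpose_rcK.
  (* The preimage is given by the same construction for the conjugate data; [conjpK] brings its type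
     back to lambda. *)
  - move=> y yRC; exists (transpose_rc (conjp lam) mu eta y).
      by have := transpose_rc_RC hlam' hsize' yRC; rewrite conjpK.
    by have := transpose_rcK hlam' hsize' yRC; rewrite conjpK.
rewrite /RCgf (reindex_fsbig _ _ _ _ bij) mulr_fsumr.
apply: eq_fsbigr => y /set_mem yRC.
by rewrite cocharge_transpose // expfzDr // -exprz_inv.
Qed.
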